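(* Let $A,B,C$ be $3$-dimensional complex vector spaces with bases $a_1,a_2,a_3$, $b_1,b_2,b_3$, $c_1,c_2,c_3$, and write $[ijk]=a_i\otimes b_j\otimes c_k$. Define $T_{t1}=[113]+[122]+[212]+[331]$, $T_{t2}=[113]+[132]+[231]+[322]$, $T_{t3}=[113]+[122]+[131]+[212]+[321]$, $T_{t4}=[113]+[122]+[212]+[231]+[321]$, $T_{t5}=[113]+[122]+[231]+[312]+[321]$, $T_{t6}=[113]+[131]+[222]+[312]+[321]$, $T_{t7}=[113]+[132]+[222]+[312]+[331]$, $T_{t8}=[122]+[213]+[231]+[312]+[321]$, $T_{t9}=[113]+[122]+[131]+[212]+[221]+[311]$. Then each $T\in\{T_{t1},\dots,T_{t9}\}$ satisfies $\dim\mathfrak{g}_{T^{\boxtimes 2}}>2\dim\mathfrak{g}_T$.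
   Context: For a tensor $T\in A\otimes B\otimes C$, $\mathfrak{g}_T$ denotes the annihilator of $T$ in the Lie algebra $(\mathfrak{gl}(A)\oplus\mathfrak{gl}(B)\oplus\mathfrak{gl}(C))/\mathbb{C}^2$ under its natural action on $A\otimes B\otimes C$ (the quotient by the $2$-dimensional subalgebra $\{(\lambda\mathrm{Id}_A,\mu\mathrm{Id}_B,\nu\mathrm{Id}_C):\lambda+\mu+\nu=0\}$ acting trivially), i.e., the Lie algebra of the symmetry group of $T$. The Kronecker square $T^{\boxtimes 2}$ is $T\otimes T$ regarded as a 3-way tensor in $(A\otimes A)\otimes(B\otimes B)\otimes(C\otimes C)$, and $\mathfrak{g}_{T^{\boxtimes 2}}$ is computed in $(\mathfrak{gl}(A^{\otimes 2})\oplus\mathfrak{gl}(B^{\otimes 2})\oplus\mathfrak{gl}(C^{\otimes 2}))/\mathbb{C}^2$. *)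

(* Defs.v *)
From HB Require Import structures.
From mathcomp Require Import all_boot all_order all_algebra.
From mathcomp Require Import reals complex.

Set Implicit Arguments.
Unset Strict Implicit.
Unset Printing Implicit Defensive.

Import GRing.Theory.
Local Open Scope ring_scope.

(* The quotient vector space vT / U, realized on a complement of U: the class
   of x is represented by the component of x along U^C in vT = U^C (+) U. That
   this is the quotient of vT by U is quot_proj_eq and quot_projK. *)
Section Quotient.
Variables (K : fieldType) (vT : vectType K) (U : {vspace vT}).

Definition quotv : vectType K := subvs_of (U^C)%VS.

Definition quot_proj (x : vT) : quotv := vsproj (U^C)%VS (daddv_pi (U^C)%VS U x).

Definition quot_repr (q : quotv) : vT := vsval q.

Lemma quot_proj_is_linear : linear quot_proj.
Proof. by move=> a x y; rewrite /quot_proj !linearP. Qed.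
HB.instance Definition _ :=
  GRing.isLinear.Build K vT quotv *:%R quot_proj quot_proj_is_linear.

Lemma quot_repr_is_linear : linear quot_repr.
Proof. exact: linearP. Qed.
HB.instance Definition _ :=
  GRing.isLinear.Build K quotv vT *:%R quot_repr quot_repr_is_linear.

Lemma quot_reprK (q : quotv) : quot_proj (quot_repr q) = q.
Proof.
apply: val_inj; rewrite /= vsprojK ?memv_pi //.
by rewrite daddv_pi_id ?subvsP // capvC capv_compl.
Qed.

Lemma quot_projK (x : vT) : quot_repr (quot_proj x) - x \in U.
Proof.
have dUC : (U^C :&: U = 0)%VS by rewrite capvC capv_compl.
have dU : (U :&: U^C = 0)%VS by rewrite capv_compl.
rewrite /quot_repr /= vsprojK ?memv_pi // -opprB memvN.
have xU : x \in (U^C + U)%VS by rewrite addvC addv_complf memvf.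
by rewrite -{1}(daddv_pi_add dUC xU) addrAC subrr add0r memv_pi.
Qed.

Lemma quot_proj_eq (x y : vT) : quot_proj x = quot_proj y <-> x - y \in U.
Proof.
have dUC : (U^C :&: U = 0)%VS by rewrite capvC capv_compl.
split=> [exy | xyU].
  rewrite -[x - y](subrKA (quot_repr (quot_proj x))) memvD //.
    by rewrite -opprB memvN quot_projK.
  by rewrite exy quot_projK.
apply/eqP; rewrite -subr_eq0 -linearB; apply/eqP/val_inj.
rewrite /= vsprojK ?memv_pi //; apply/eqP.
have := daddv_pi_id (capv_compl U) xyU.
have xyT : x - y \in (U^C + U)%VS by rewrite addvC addv_complf memvf.
move=> e; have /eqP := daddv_pi_add dUC xyT.
by rewrite e -subr_eq0 addrK.
Qed.

End Quotient.

Section Tensors.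
Variable K : fieldType.

(* The coordinate space K^I, with a basis indexed by I; (K^I) (x) (K^J) is
   K^(I * J), the basis vector indexed by (i, j) being e_i (x) e_j. *)
Definition cspace (I : finType) : vectType K := {ffun I -> K^o}.

(* (K^I) (x) (K^J) (x) (K^L) *)
Definition tensor (I J L : finType) : vectType K := cspace (I * J * L)%type.

(* T (x) T, regrouped as an element of
   (K^I (x) K^I) (x) (K^J (x) K^J) (x) (K^L (x) K^L). *)
Definition kron_square (I J L : finType) (T : tensor I J L) :
    tensor (I * I)%type (J * J)%type (L * L)%type :=
  [ffun x : (I * I) * (J * J) * (L * L) =>
     T (x.1.1.1, x.1.2.1, x.2.1) * T (x.1.1.2, x.1.2.2, x.2.2)].

Section Symmetry.
Variables I J L : finType.

(* The vector space underlying gl(A) (+) gl(B) (+) gl(C). *)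
Definition gl3 : vectType K :=
  ('End(cspace I) * 'End(cspace J) * 'End(cspace L))%type.

(* The natural action: (X, Y, Z) acts as
   X (x) 1 (x) 1 + 1 (x) Y (x) 1 + 1 (x) 1 (x) Z, each endomorphism being
   applied to the fibers of T in its own direction. *)
Definition gl3_act (T : tensor I J L) (g : gl3) : tensor I J L :=
  [ffun x : I * J * L =>
     let: (i, j, l) := x in
       g.1.1 [ffun i' => T (i', j, l)] i
     + g.1.2 [ffun j' => T (i, j', l)] j
     + g.2   [ffun l' => T (i, j, l')] l].

Lemma gl3_actE (T : tensor I J L) (X : 'End(cspace I)) (Y : 'End(cspace J))
    (Z : 'End(cspace L)) i j l :
  gl3_act T (X, Y, Z) (i, j, l) =
    X [ffun i' => T (i', j, l)] i + Y [ffun j' => T (i, j', l)] j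
    + Z [ffun l' => T (i, j, l')] l.
Proof. by rewrite ffunE. Qed.

Let lin1 (I0 : finType) a (X X' : 'End(cspace I0)) v i :
  (a *: X + X') v i = a *: X v i + X' v i.
Proof. by rewrite add_lfunE scale_lfunE !ffunE. Qed.

Lemma gl3_act_is_linear (T : tensor I J L) : linear (gl3_act T).
Proof.
move=> a [[X Y] Z] [[X' Y'] Z']; apply/ffunP=> -[[i j] l].
have -> : a *: (X, Y, Z) + (X', Y', Z')
  = (a *: X + X', a *: Y + Y', a *: Z + Z') :> gl3 by [].
rewrite [RHS]ffunE [X in _ = X + _]ffunE !gl3_actE !lin1 !scalerDr.
by rewrite (addrACA (a *: _)) [LHS]addrACA.
Qed.
HB.instance Definition _ (T : tensor I J L) :=
  GRing.isLinear.Build K gl3 (tensor I J L) *:%R (gl3_act T)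
    (gl3_act_is_linear T).

Definition scalars3 (a b c : K) : gl3 := (a *: \1%VF, b *: \1%VF, c *: \1%VF).

Definition gl3_triv : {vspace gl3} :=
  <<[:: scalars3 1 (-1) 0; scalars3 0 1 (-1)]>>%VS.

Lemma gl3_trivP (g : gl3) :
  reflect (exists a b c : K, a + b + c = 0 /\ g = scalars3 a b c)
          (g \in gl3_triv).
Proof.
have lin u v : u *: scalars3 1 (-1) 0 + v *: scalars3 0 1 (-1)
    = scalars3 u (v - u) (- v).
  rewrite /scalars3; congr (_, _, _); rewrite /= !scalerA -scalerDl.
  - by rewrite mulr1 mulr0 addr0.
  - by rewrite mulrN1 mulr1 addrC.
  - by rewrite mulr0 mulrN1 add0r.
rewrite /gl3_triv span_cons span_seq1; apply: (iffP memv_addP).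
  move=> [_ /vlineP[u ->] [_ /vlineP[v ->] ->]].
  exists u, (v - u), (- v); split; last exact: lin.
  by rewrite subrKC subrr.
move=> [a [b [c [abc ->]]]].
exists (a *: scalars3 1 (-1) 0); first exact: memvZ (memv_line _).
exists (- c *: scalars3 0 1 (-1)); first exact: memvZ (memv_line _).
by rewrite lin opprK -(addr0_eq abc) opprK addrAC subrr add0r.
Qed.

Lemma gl3_act_triv (T : tensor I J L) (g : gl3) :
  g \in gl3_triv -> gl3_act T g = 0.
Proof.
move=> /gl3_trivP[a [b [c [abc ->]]]]; apply/ffunP=> -[[i j] l].
rewrite gl3_actE !scale_lfunE !id_lfunE !ffunE -!scalerDl abc.
exact: scale0r.
Qed.

(* (gl(A) (+) gl(B) (+) gl(C)) / K^2 and its induced action. *)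
Definition gl3_quot : vectType K := quotv gl3_triv.

Definition gl3_quot_act (T : tensor I J L) (q : gl3_quot) : tensor I J L :=
  gl3_act T (quot_repr q).

Lemma gl3_quot_act_proj (T : tensor I J L) (g : gl3) :
  gl3_quot_act T (quot_proj gl3_triv g) = gl3_act T g.
Proof.
apply/eqP; rewrite -subr_eq0 -linearB /= gl3_act_triv //; exact: quot_projK.
Qed.

Lemma gl3_quot_act_is_linear (T : tensor I J L) : linear (gl3_quot_act T).
Proof. by move=> a p q; rewrite /gl3_quot_act !linearP. Qed.
HB.instance Definition _ (T : tensor I J L) :=
  GRing.isLinear.Build K gl3_quot (tensor I J L) *:%R (gl3_quot_act T)
    (gl3_quot_act_is_linear T).

(* g_T *)
Definition symmetry_algebra (T : tensor I J L) : {vspace gl3_quot} :=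
  lker (linfun (gl3_quot_act T)).

Lemma mem_symmetry_algebra (T : tensor I J L) (q : gl3_quot) :
  (q \in symmetry_algebra T) = (gl3_quot_act T q == 0).
Proof. by rewrite memv_ker lfunE. Qed.

End Symmetry.

(* [ijk] = a_i (x) b_j (x) c_k, with i, j, k in {1, 2, 3}; the index i of the
   basis of K^3 corresponds to the ordinal of value i - 1. *)
Definition bt (i j k : nat) : tensor 'I_3 'I_3 'I_3 :=
  [ffun x : 'I_3 * 'I_3 * 'I_3 =>
     ((x.1.1.+1 == i) && (x.1.2.+1 == j) && (x.2.+1 == k))%:R].

Definition T_t1 := bt 1 1 3 + bt 1 2 2 + bt 2 1 2 + bt 3 3 1.
Definition T_t2 := bt 1 1 3 + bt 1 3 2 + bt 2 3 1 + bt 3 2 2.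
Definition T_t3 := bt 1 1 3 + bt 1 2 2 + bt 1 3 1 + bt 2 1 2 + bt 3 2 1.
Definition T_t4 := bt 1 1 3 + bt 1 2 2 + bt 2 1 2 + bt 2 3 1 + bt 3 2 1.
Definition T_t5 := bt 1 1 3 + bt 1 2 2 + bt 2 3 1 + bt 3 1 2 + bt 3 2 1.
Definition T_t6 := bt 1 1 3 + bt 1 3 1 + bt 2 2 2 + bt 3 1 2 + bt 3 2 1.
Definition T_t7 := bt 1 1 3 + bt 1 3 2 + bt 2 2 2 + bt 3 1 2 + bt 3 3 1.
Definition T_t8 := bt 1 2 2 + bt 2 1 3 + bt 2 3 1 + bt 3 1 2 + bt 3 2 1.
Definition T_t9 :=
  bt 1 1 3 + bt 1 2 2 + bt 1 3 1 + bt 2 1 2 + bt 2 2 1 + bt 3 1 1.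

End Tensors.

(* Main.v *)
(* The endomorphisms g (x) 1 + 1 (x) g' with g, g' in g_T annihilate T (x) T, and
   they form a space of dimension 2 dim g_T modulo the scalars, so one further
   annihilator suffices.  If X, acting on A, and Y, acting on B, satisfy
   X.T = Y.T, then (X (x) X).(T (x) T) = (Y (x) Y).(T (x) T), so
   (X (x) X, - Y (x) Y, 0) annihilates T (x) T; it is new as soon as X is not
   scalar.  Each of the nine tensors admits such a pair of matrix units, on the
   factors A and B or on the factors B and C. *)

Require Import Defs.
From HB Require Import structures.
From mathcomp Require Import all_boot all_order all_algebra.
From mathcomp Require Import reals complex.
From mathcomp Require Import ring.

Set Implicit Arguments.
Unset Strict Implicit.
Unset Printing Implicit Defensive.

Import GRing.Theory.
Local Open Scope ring_scope.

Lemma cscaleE (K : fieldType) (I : finType) (a : K) (u : cspace K I) i :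
  (a *: u) i = a * u i.
Proof. by rewrite ffunE. Qed.

(** * Tensor products of endomorphisms of a coordinate space *)

Section TensorProductOfEndomorphisms.
Variables (K : fieldType) (I : finType).
Implicit Types (X Y : 'End(cspace K I)) (u v : cspace K I).

Definition prod_vec u v : cspace K (I * I)%type := [ffun p => u p.1 * v p.2].

(** With [w] read as a matrix, [Y] acts on its rows and then [X] on the resulting columns; this is X
    (x) Y on the whole space, without decomposing [w]. *)
Definition tens_fun X Y (w : cspace K (I * I)%type) : cspace K (I * I)%type :=
  [ffun p => X [ffun i => Y [ffun j => w (i, j)] p.2] p.1].

Lemma tens_fun_is_linear X Y : linear (tens_fun X Y).
Proof.
move=> a w w'; apply/ffunP=> p; rewrite !ffunE.
set f := [ffun i => _]; set g := [ffun i => _]; set h := [ffun i => _].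
suff -> : f = a *: g + h by rewrite linearP !ffunE.
apply/ffunP=> i; rewrite !ffunE.
set f' := [ffun i => _]; set g' := [ffun i => _]; set h' := [ffun i => _].
suff -> : f' = a *: g' + h' by rewrite linearP !ffunE.
by apply/ffunP=> j; rewrite !ffunE.
Qed.
HB.instance Definition _ X Y :=
  GRing.isLinear.Build K (cspace K (I * I)%type) (cspace K (I * I)%type) *:%R
    (tens_fun X Y) (tens_fun_is_linear X Y).

Definition tens X Y : 'End(cspace K (I * I)%type) := linfun (tens_fun X Y).

Lemma tens_prod_vec X Y u v p :
  tens X Y (prod_vec u v) p = X u p.1 * Y v p.2.
Proof.
rewrite lfunE ffunE.
set f := [ffun i => _].
suff -> : f = (Y v p.2 : K) *: u by rewrite linearZ cscaleE mulrC.
apply/ffunP=> i; rewrite !ffunE.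
set g := [ffun i => _].
suff -> : g = (u i : K) *: v by rewrite linearZ cscaleE mulrC.
by apply/ffunP=> j; rewrite cscaleE !ffunE.
Qed.

Lemma tensDZl a X X' Y : tens (a *: X + X') Y = a *: tens X Y + tens X' Y.
Proof.
apply/lfunP=> w; rewrite add_lfunE scale_lfunE !lfunE; apply/ffunP=> p.
by rewrite !ffunE add_lfunE scale_lfunE !ffunE.
Qed.

Lemma tensDZr a X Y Y' : tens X (a *: Y + Y') = a *: tens X Y + tens X Y'.
Proof.
apply/lfunP=> w; rewrite add_lfunE scale_lfunE !lfunE; apply/ffunP=> p.
rewrite !ffunE.
set f := [ffun i => _]; set g := [ffun i => _]; set h := [ffun i => _].
suff -> : f = a *: g + h by rewrite linearP !ffunE.
by apply/ffunP=> i; rewrite !ffunE add_lfunE scale_lfunE !ffunE.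
Qed.

Definition leibniz X Y : 'End(cspace K (I * I)%type) := tens X \1%VF + tens \1%VF Y.

Lemma leibniz_prod_vec X Y u v p :
  leibniz X Y (prod_vec u v) p = X u p.1 * v p.2 + u p.1 * Y v p.2.
Proof. by rewrite add_lfunE ffunE !tens_prod_vec !id_lfunE. Qed.

Lemma leibnizP a X X' Y Y' :
  leibniz (a *: X + X') (a *: Y + Y') = a *: leibniz X Y + leibniz X' Y'.
Proof. by rewrite /leibniz tensDZl tensDZr scalerDr addrACA. Qed.

Definition basis_vec (i : I) : cspace K I := [ffun j => (j == i)%:R].

(** Taking one tensor factor to be the basis vector at [i0], and reading coordinate [i0] there,
    leaves X u = (a - y) u with y the diagonal entry of Y at [i0]; symmetrically for Y. *)
Lemma leibniz_scalar (i0 : I) X Y a :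
  leibniz X Y = a *: \1%VF ->
  (exists x, X = x *: \1%VF) /\ (exists y, Y = y *: \1%VF).
Proof.
move=> e.
have key u v i j : X u i * v j + u i * Y v j = a * (u i * v j).
  by rewrite -(leibniz_prod_vec _ _ _ _ (i, j)) e scale_lfunE id_lfunE cscaleE ffunE.
have b1 : basis_vec i0 i0 = 1 by rewrite ffunE eqxx.
split.
  exists (a - Y (basis_vec i0) i0); apply/lfunP=> u; apply/ffunP=> i.
  have := key u (basis_vec i0) i i0.
  rewrite scale_lfunE id_lfunE cscaleE b1 => /eqP; rewrite -subr_eq0 => /eqP e1.
  by apply/eqP; rewrite -subr_eq0 -e1; apply/eqP; ring.
exists (a - X (basis_vec i0) i0); apply/lfunP=> v; apply/ffunP=> j.
have := key (basis_vec i0) v i0 j.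
rewrite scale_lfunE id_lfunE cscaleE b1 => /eqP; rewrite -subr_eq0 => /eqP e1.
by apply/eqP; rewrite -subr_eq0 -e1; apply/eqP; ring.
Qed.

(* Evaluating the identity on u (x) v and on u (x) b, for a basis vector b, and
   eliminating X u between the two shows that Z u is a multiple of u with a
   factor that does not depend on u. *)
Lemma leibniz_tens_free (i0 : I) X Y Z a c :
  Z \notin <[\1%VF]>%VS -> leibniz X Y + c *: tens Z Z = a *: \1%VF -> c = 0.
Proof.
move=> Znsc e; apply: contraNeq Znsc => c0.
have key u v i j :
    X u i * v j + u i * Y v j + c * (Z u i * Z v j) = a * (u i * v j).
  rewrite -(leibniz_prod_vec _ _ _ _ (i, j)) -(tens_prod_vec _ _ _ _ (i, j)).
  rewrite -cscaleE -scale_lfunE.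
  transitivity ((leibniz X Y + c *: tens Z Z) (prod_vec u v) (i, j)).
    by rewrite add_lfunE [RHS]ffunE.
  by rewrite e scale_lfunE id_lfunE cscaleE ffunE.
pose b := basis_vec i0; pose z := Z b i0 : K.
have b1 : b i0 = 1 by rewrite ffunE eqxx.
have scalarP x : (forall v j, Z v j = x * v j) -> Z \in <[\1%VF]>%VS.
  move=> h; suff -> : Z = x *: \1%VF by exact: memvZ (memv_line _).
  by apply/lfunP=> v; apply/ffunP=> j; rewrite scale_lfunE id_lfunE cscaleE h.
(* If Z v = z v for all v, then Z is scalar. Otherwise some coordinate of Z v - z v is nonzero, and
   dividing by it makes Z scalar as well. *)
apply: contraT => Znsc; move: (Znsc); rewrite (scalarP z) // => v j.
apply: contraNeq Znsc; rewrite -subr_eq0 => d0.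
apply: (scalarP (- (Y v j - Y b i0 * v j) / (c * (Z v j - z * v j)))) => u i.
have cd0 := mulf_neq0 c0 d0; apply: (mulfI cd0).
rewrite mulrA [X in _ = X * _]mulrC divfK //.
have := congr2 (fun s t => s - v j * t) (key u v i j) (key u b i i0).
rewrite b1 -/z => /eqP; rewrite -subr_eq0 => /eqP e1.
by apply/eqP; rewrite -subr_eq0 -e1; apply/eqP; ring.
Qed.
End TensorProductOfEndomorphisms.

(** * Annihilators of the Kronecker square *)

Section SymmetryOfKroneckerSquare.
Variables (K : fieldType) (I J L : finType) (T : tensor K I J L).
Implicit Types (g : gl3 K I J L).

Definition gl3_leibniz g g' : gl3 K (I * I)%type (J * J)%type (L * L)%type :=
  (leibniz g.1.1 g'.1.1, leibniz g.1.2 g'.1.2, leibniz g.2 g'.2).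

(** Because the fibers decompose, the action on the Kronecker square only needs the values of
    endomorphisms on decomposable vectors. *)
Lemma kron_fiber1 j l :
  [ffun i => kron_square T (i, j, l)] =
  prod_vec [ffun i => T (i, j.1, l.1)] [ffun i => T (i, j.2, l.2)].
Proof. by apply/ffunP=> i; rewrite !ffunE. Qed.

Lemma kron_fiber2 i l :
  [ffun j => kron_square T (i, j, l)] =
  prod_vec [ffun j => T (i.1, j, l.1)] [ffun j => T (i.2, j, l.2)].
Proof. by apply/ffunP=> j; rewrite !ffunE. Qed.

Lemma kron_fiber3 i j :
  [ffun l => kron_square T (i, j, l)] =
  prod_vec [ffun l => T (i.1, j.1, l)] [ffun l => T (i.2, j.2, l)].
Proof. by apply/ffunP=> l; rewrite !ffunE. Qed.

Definition kron_fiber := (kron_fiber1, kron_fiber2, kron_fiber3).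

(** Leibniz rule: at a pair of indices (p, q) the action yields (g.T)(p) T(q) + T(p) (g'.T)(q). *)
Lemma gl3_act_leibniz g g' :
  gl3_act T g = 0 -> gl3_act T g' = 0 ->
  gl3_act (kron_square T) (gl3_leibniz g g') = 0.
Proof.
case: g g' => [[X Y] Z] [[X' Y'] Z'] /ffunP h /ffunP h'.
apply/ffunP=> -[[i j] l]; have := h (i.1, j.1, l.1); have := h' (i.2, j.2, l.2).
rewrite !gl3_actE !kron_fiber !leibniz_prod_vec /= !ffunE /= => e' e.
have := congr2 (fun s t => s * T (i.2, j.2, l.2) + T (i.1, j.1, l.1) * t) e e'.
by rewrite mul0r mulr0 addr0 => <-; ring.
Qed.

Lemma gl3_leibnizP a g h g' h' :
  gl3_leibniz (a *: g + h) (a *: g' + h') =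
  a *: gl3_leibniz g g' + gl3_leibniz h h'.
Proof. by congr (_, _, _); rewrite /= leibnizP. Qed.

Lemma tensor_neq0_coord : T != 0 -> exists x, T x != 0.
Proof.
move=> T0; apply/existsP; apply: contraT; rewrite negb_exists => /forallP h.
by case/eqP: T0; apply/ffunP=> x; rewrite !ffunE; apply/eqP/negPn.
Qed.

(** By [leibniz_scalar] all components are scalar, so [g] and [g'] each multiply T by the sum of
    their three scalars; at a nonzero coordinate of T this sum must vanish. *)
Lemma gl3_leibniz_triv g g' :
  T != 0 -> gl3_act T g = 0 -> gl3_act T g' = 0 ->
  gl3_leibniz g g' \in gl3_triv K _ _ _ ->
  g \in gl3_triv K I J L /\ g' \in gl3_triv K I J L.
Proof.
move=> T0 gT gT' /gl3_trivP[a [b [c [_ [e1 e2 e3]]]]].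
have [[[i j] l] Tijl] := tensor_neq0_coord T0.
case: g g' => [[X Y] Z] [[X' Y'] Z'] /= in gT gT' e1 e2 e3 *.
have [[x ?] [x' ?]] := leibniz_scalar i e1.
have [[y ?] [y' ?]] := leibniz_scalar j e2.
have [[z ?] [z' ?]] := leibniz_scalar l e3.
subst.
have triv u v w : gl3_act T (scalars3 I J L u v w) = 0 ->
    scalars3 I J L u v w \in gl3_triv K I J L.
  move=> /ffunP/(_ (i, j, l)); rewrite gl3_actE !scale_lfunE !id_lfunE !ffunE.
  rewrite -!scalerDl => /eqP; rewrite scaler_eq0 (negPf Tijl) orbF => /eqP e.
  by apply/gl3_trivP; exists u, v, w.
by split; [exact: triv gT | exact: triv gT'].
Qed.

(** The map (s, s', c) -> s (x) 1 + 1 (x) s' + c E embeds a space of dimension 2 dim g_T + 1 into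
    the symmetry algebra of the square. *)
Lemma symmetry_dim_kron_square (E : gl3 K (I * I)%type (J * J)%type (L * L)%type) :
  T != 0 -> gl3_act (kron_square T) E = 0 ->
  (forall g g' c, gl3_leibniz g g' + c *: E \in gl3_triv K _ _ _ -> c = 0) ->
  (\dim (symmetry_algebra (kron_square T)) > 2 * \dim (symmetry_algebra T))%N.
Proof.
move=> T0 ET Efree.
pose S := subvs_of (symmetry_algebra T).
pose D : vectType K := (S * S * K^o)%type.
pose r (s : S) := quot_repr (vsval s).
have rP a s s' : r (a *: s + s') = a *: r s + r s'.
  by rewrite /r !linearP.
have rT s : gl3_act T (r s) = 0.
  by apply/eqP; have := subvsP s; rewrite mem_symmetry_algebra.
pose f (d : D) := quot_proj (gl3_triv K _ _ _)
  (gl3_leibniz (r d.1.1) (r d.1.2) + (d.2 : K) *: E).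
have f_lin : linear f.
  move=> a [[s s'] c] [[t t'] c']; rewrite /f -linearP; congr quot_proj.
  by rewrite /= !rP gl3_leibnizP scalerDl scalerDr scalerA addrACA.
pose F := linfun (HB.pack f (GRing.isLinear.Build K D _ *:%R f f_lin)
  : {linear D -> gl3_quot K _ _ _}).
have FE d : F d = f d by rewrite lfunE.
(* On the kernel, [Efree] gives c = 0; then [gl3_leibniz_triv] makes both representatives trivial,
   so both classes vanish. *)
have F_inj : lker F == 0%VS.
  rewrite -subv0; apply/subvP=> -[[s s'] c]; rewrite memv_ker FE /f /=.
  rewrite -(linear0 (quot_proj (gl3_triv K _ _ _))) => /eqP/quot_proj_eq.
  rewrite subr0 => h; have c0 := Efree _ _ _ h.
  move: h; rewrite c0 scale0r addr0 => /(gl3_leibniz_triv T0 (rT s) (rT s'))[].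
  have r0 t : r t \in gl3_triv K I J L -> t = 0.
    rewrite -[r t]subr0 => /quot_proj_eq; rewrite quot_reprK linear0 => t0.
    exact: val_inj.
  by move=> /r0-> /r0->; rewrite mem0v.
have F_sym : (limg F <= symmetry_algebra (kron_square T))%VS.
  apply/subvP=> _ /memv_imgP[d _ ->]; rewrite FE mem_symmetry_algebra.
  by rewrite gl3_quot_act_proj linearD linearZ /= ET scaler0 addr0 gl3_act_leibniz.
apply: leq_trans (dimvS F_sym); rewrite limg_dim_eq; last first.
  by rewrite (eqP F_inj) capv0.
have -> : \dim {:D} = (\dim (symmetry_algebra T) + \dim (symmetry_algebra T) + 1)%N.
  by rewrite dimvf.
by rewrite mul2n addnn addn1.
Qed.

(** At a pair of indices, X (x) X and Y (x) Y yield products of two coordinates of X.T and of Y.T,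
    which agree. Independence is tested on the first factor, where X is not scalar. *)
Lemma symmetry_dim_kron_square12 X Y :
  T != 0 -> gl3_act T (X, - Y, 0) = 0 -> X \notin <[\1%VF]>%VS ->
  (\dim (symmetry_algebra (kron_square T)) > 2 * \dim (symmetry_algebra T))%N.
Proof.
move=> T0 XYT Xnsc.
have [[[i _] _] _] := tensor_neq0_coord T0.
apply: (symmetry_dim_kron_square (E := (tens X X, - tens Y Y, 0))) => //.
  apply/ffunP=> -[[i' j'] l'].
  rewrite gl3_actE !kron_fiber opp_lfunE ffunE !tens_prod_vec zero_lfunE !ffunE addr0.
  have XY u : X [ffun i => T (i, u.1.2, u.2)] u.1.1 =
              Y [ffun j => T (u.1.1, j, u.2)] u.1.2.
    case: u => [[u v] w] /=; move/ffunP/(_ (u, v, w)): XYT.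
    rewrite gl3_actE opp_lfunE zero_lfunE !ffunE addr0 => /eqP.
    by rewrite subr_eq0 => /eqP.
  have := XY (i'.1, j'.1, l'.1); have := XY (i'.2, j'.2, l'.2).
  by move=> /= -> ->; rewrite subrr.
move=> g g' c /gl3_trivP[a [_ [_ [_ [e _ _]]]]].
exact: (leibniz_tens_free i Xnsc e).
Qed.

(** The same argument on the last two factors, with independence tested on the second. *)
Lemma symmetry_dim_kron_square23 Y Z :
  T != 0 -> gl3_act T (0, Y, - Z) = 0 -> Y \notin <[\1%VF]>%VS ->
  (\dim (symmetry_algebra (kron_square T)) > 2 * \dim (symmetry_algebra T))%N.
Proof.
move=> T0 YZT Ynsc.
have [[[_ j] _] _] := tensor_neq0_coord T0.
apply: (symmetry_dim_kron_square (E := (0, tens Y Y, - tens Z Z))) => //.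
  apply/ffunP=> -[[i' j'] l'].
  rewrite gl3_actE !kron_fiber opp_lfunE ffunE !tens_prod_vec zero_lfunE !ffunE add0r.
  have YZ u : Y [ffun j => T (u.1.1, j, u.2)] u.1.2 =
              Z [ffun l => T (u.1.1, u.1.2, l)] u.2.
    case: u => [[u v] w] /=; move/ffunP/(_ (u, v, w)): YZT.
    rewrite gl3_actE opp_lfunE zero_lfunE !ffunE add0r => /eqP.
    by rewrite subr_eq0 => /eqP.
  have := YZ (i'.1, j'.1, l'.1); have := YZ (i'.2, j'.2, l'.2).
  by move=> /= -> ->; rewrite subrr.
move=> g g' c /gl3_trivP[_ [b [_ [_ [_ e _]]]]].
exact: (leibniz_tens_free j Ynsc e).
Qed.

End SymmetryOfKroneckerSquare.

(** * Matrix units *)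

Section MatrixUnits.
Variables (K : fieldType) (I : finType).

Definition unit_fun (i j : I) (v : cspace K I) : cspace K I :=
  [ffun k => (k == i)%:R * v j].

Lemma unit_fun_is_linear i j : linear (unit_fun i j).
Proof.
move=> a v w; apply/ffunP=> k; rewrite [RHS]ffunE cscaleE !ffunE.
by rewrite -[a *: v j]/(a * v j) mulrDr mulrCA.
Qed.
HB.instance Definition _ i j :=
  GRing.isLinear.Build K (cspace K I) (cspace K I) *:%R
    (unit_fun i j) (unit_fun_is_linear i j).

Definition unit_end i j : 'End(cspace K I) := linfun (unit_fun i j).

Lemma unit_endE i j v k : unit_end i j v k = (k == i)%:R * v j.
Proof. by rewrite lfunE ffunE. Qed.

(** The image lies on the line of e_i, so a coordinate k different from i forces the scalar to be 0,
    whereas e_j is sent to e_i. *)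
Lemma unit_end_nonscalar i j : (1 < #|I|)%N -> unit_end i j \notin <[\1%VF]>%VS.
Proof.
move=> /card_gt1P[x [y [_ _ xy]]].
have [k ki] : exists k, k != i.
  by have [xi|] := eqVneq x i; [exists y; rewrite -xi eq_sym | exists x].
apply/negP=> /vlineP[c /lfunP e].
have := congr1 (fun v : cspace K I => v k) (e (basis_vec K k)).
rewrite scale_lfunE id_lfunE cscaleE unit_endE !ffunE (negPf ki) mul0r eqxx mulr1.
move=> c0; have := congr1 (fun v : cspace K I => v i) (e (basis_vec K j)).
rewrite scale_lfunE id_lfunE cscaleE unit_endE -c0 !ffunE !eqxx mul0r mul1r.
by apply/eqP; rewrite oner_eq0.
Qed.

End MatrixUnits.

(** * A criterion by comparing slices of the tensor *)

Section SymmetryByMatrixUnits.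
Variables (K : fieldType) (I J L : finType) (T : tensor K I J L).

(** This makes X.T = Y.T, for X taking e_i2 to e_i1 and Y taking e_j2 to e_j1, a finite comparison
    of two slices of T. *)
Lemma symmetry_dim_unit12 (i1 i2 : I) (j1 j2 : J) :
  (1 < #|I|)%N -> T != 0 ->
  (forall x y z, (x == i1)%:R * T (i2, y, z) = (y == j1)%:R * T (x, j2, z)) ->
  (\dim (symmetry_algebra (kron_square T)) > 2 * \dim (symmetry_algebra T))%N.
Proof.
move=> I_gt1 T0 h.
apply: (symmetry_dim_kron_square12 (X := unit_end K i1 i2)
          (Y := unit_end K j1 j2)) => //; last exact: unit_end_nonscalar.
apply/ffunP=> -[[x y] z]; rewrite gl3_actE opp_lfunE zero_lfunE ffunE !unit_endE.
by rewrite !ffunE addr0; apply/eqP; rewrite subr_eq0 h.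
Qed.

Lemma symmetry_dim_unit23 (j1 j2 : J) (l1 l2 : L) :
  (1 < #|J|)%N -> T != 0 ->
  (forall x y z, (y == j1)%:R * T (x, j2, z) = (z == l1)%:R * T (x, y, l2)) ->
  (\dim (symmetry_algebra (kron_square T)) > 2 * \dim (symmetry_algebra T))%N.
Proof.
move=> J_gt1 T0 h.
apply: (symmetry_dim_kron_square23 (Y := unit_end K j1 j2)
          (Z := unit_end K l1 l2)) => //; last exact: unit_end_nonscalar.
apply/ffunP=> -[[x y] z]; rewrite gl3_actE opp_lfunE zero_lfunE ffunE !unit_endE.
by rewrite !ffunE add0r; apply/eqP; rewrite subr_eq0 unit_endE ffunE h.
Qed.

Lemma tensor_neq0 x : T x = 1 -> T != 0.
Proof. by move=> e; apply: contra_eq_neq e => ->; rewrite ffunE eq_sym oner_neq0. Qed.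

End SymmetryByMatrixUnits.

(** * The nine tensors *)

(* The coordinates are casts of naturals, so that after factoring the cast out
   the cases are closed by computation. *)
Ltac tensor_cases :=
  let x := fresh in let y := fresh in let z := fresh in
  move=> x y z; rewrite !ffunE -!natrD -!natrM; congr (_%:R);
  move: x y z; do 3![case=> [[|[|[|//]]] ?]] => //.

Theorem theorem6p3 (R : realType) (T : tensor R[i] 'I_3 'I_3 'I_3) :
  T \in [:: T_t1 R[i]; T_t2 R[i]; T_t3 R[i]; T_t4 R[i]; T_t5 R[i];
            T_t6 R[i]; T_t7 R[i]; T_t8 R[i]; T_t9 R[i]] ->
  (\dim (symmetry_algebra (kron_square T)) > 2 * \dim (symmetry_algebra T))%N.
Proof.
pose o0 : 'I_3 := @Ordinal 3 0 isT; pose o1 : 'I_3 := @Ordinal 3 1 isT.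
pose o2 : 'I_3 := @Ordinal 3 2 isT.
rewrite !inE; case/or4P; last case/or4P; last case/orP; last case/orP.
all: move=> /eqP ->.
(* In each case both units send T to the same basis tensor. Here a_2 -> a_1 takes [212], and b_2 ->
   b_1 takes [122], to [112]. *)
- apply: (symmetry_dim_unit12 (i1 := o0) (i2 := o1) (j1 := o0) (j2 := o1)).
  + by rewrite card_ord.
  + by apply: (tensor_neq0 (x := (o0, o0, o2))); rewrite !ffunE -!natrD.
  + by tensor_cases.
(* Only [322] contains a_3, and only it contains b_2. *)
- apply: (symmetry_dim_unit12 (i1 := o2) (i2 := o2) (j1 := o1) (j2 := o1)).
  + by rewrite card_ord.
  + by apply: (tensor_neq0 (x := (o0, o0, o2))); rewrite !ffunE -!natrD.
  + by tensor_cases.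
(* [321] and [131] both go to [121]. *)
- apply: (symmetry_dim_unit12 (i1 := o0) (i2 := o2) (j1 := o1) (j2 := o2)).
  + by rewrite card_ord.
  + by apply: (tensor_neq0 (x := (o0, o0, o2))); rewrite !ffunE -!natrD.
  + by tensor_cases.
(* [321] and [231] both go to [221]. *)
- apply: (symmetry_dim_unit12 (i1 := o1) (i2 := o2) (j1 := o1) (j2 := o2)).
  + by rewrite card_ord.
  + by apply: (tensor_neq0 (x := (o0, o0, o2))); rewrite !ffunE -!natrD.
  + by tensor_cases.
(* Only [231] contains a_2, and only it contains b_3. *)
- apply: (symmetry_dim_unit12 (i1 := o1) (i2 := o1) (j1 := o2) (j2 := o2)).
  + by rewrite card_ord.
  + by apply: (tensor_neq0 (x := (o0, o0, o2))); rewrite !ffunE -!natrD.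
  + by tensor_cases.
(* On B and C: [131] and [113] both go to [111]. *)
- apply: (symmetry_dim_unit23 (j1 := o0) (j2 := o2) (l1 := o0) (l2 := o2)).
  + by rewrite card_ord.
  + by apply: (tensor_neq0 (x := (o0, o0, o2))); rewrite !ffunE -!natrD.
  + by tensor_cases.
(* Only [222] contains a_2, and only it contains b_2. *)
- apply: (symmetry_dim_unit12 (i1 := o1) (i2 := o1) (j1 := o1) (j2 := o1)).
  + by rewrite card_ord.
  + by apply: (tensor_neq0 (x := (o0, o0, o2))); rewrite !ffunE -!natrD.
  + by tensor_cases.
(* On B and C: [231] and [213] both go to [211]. *)
- apply: (symmetry_dim_unit23 (j1 := o0) (j2 := o2) (l1 := o0) (l2 := o2)).
  + by rewrite card_ord.
  + by apply: (tensor_neq0 (x := (o0, o1, o1))); rewrite !ffunE -!natrD.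
  + by tensor_cases.
(* [311] and [131] both go to [111]. *)
- apply: (symmetry_dim_unit12 (i1 := o0) (i2 := o2) (j1 := o0) (j2 := o2)).
  + by rewrite card_ord.
  + by apply: (tensor_neq0 (x := (o0, o0, o2))); rewrite !ffunE -!natrD.
  + by tensor_cases.
Qed.
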